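(* Assume that (i) the $\mathbb{P}$-essential infimum of $V$ is $0$ and the $\mathbb{P}$-essential supremum of $V$ is $1$, and (ii) for every $h\in(0,1)$ and $\ell\in\mathbb{N}$, $\mathbb{P}(V(T_y\omega)\le h \text{ for all } y\in\{0,\ldots,\ell\})>0$ and $\mathbb{P}(V(T_y\omega)\ge h \text{ for all } y\in\{0,\ldots,\ell\})>0$. Let $\delta=1$, $\beta>0$ and $\theta\in\mathbb{R}$. Then for $\mathbb{P}$-a.e. $\omega$ the limit $$u_o(t,x\,|\,1,\beta,\theta)=\lim_{\epsilon\to0}\epsilon\, u([\epsilon^{-1}t],[\epsilon^{-1}x],\omega\,|\,1,\beta,\theta)$$ exists for every $t>0$ and $x\in\mathbb{R}$. Moreover, $u_o(t,x\,|\,1,\beta,\theta)=t\,\overline H_{1,\beta}(\theta)+\theta x$, where the effective Hamiltonian $\overline H_{1,\beta}(\theta):=u_o(1,0\,|\,1,\beta,\theta)$ is deterministic and given by $$\overline H_{1,\beta}(\theta)=\begin{cases}0&\text{if }|\theta|<\beta\mathbb{E}[V(\cdot)],\\ \beta\mathbb{E}[V(\cdot)]-|\theta|&\text{if }|\theta|\ge\beta\mathbb{E}[V(\cdot)].\end{cases}$$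
   Context: $(\Omega,\mathcal{F},\mathbb{P})$ is a probability space equipped with an ergodic invertible measure-preserving transformation $T:\Omega\to\Omega$; $\mathbb{E}$ is expectation under $\mathbb{P}$; $T_0=I$, $T_k=T\circ T_{k-1}$ and $T_{-k}=(T_k)^{-1}$ for $k\in\mathbb{N}=\{1,2,\ldots\}$. $V:\Omega\to[0,1]$ is a nonconstant measurable function. $[\cdot]$ denotes the floor function. For $n\in\mathbb{N}$ and $\delta\in[0,1]$, $\mathcal{P}_n(\delta)$ is the set of all $\pi=(\pi_0,\ldots,\pi_{n-1})$ where each $\pi_i=\pi_i(n,\omega,y,\pm1)\in[0,1]^2$ is $\mathcal{F}$-measurable in $\omega$ and satisfies $\pi_i(n,\omega,y,-1)+\pi_i(n,\omega,y,1)=1$ and $|\pi_i(n,\omega,y,1)-\pi_i(n,\omega,y,-1)|\le\delta$ for every $i\in\{0,\ldots,n-1\}$, $\omega\in\Omega$, $y\in\mathbb{Z}$. Given $\omega\in\Omega$ and $x\in\mathbb{Z}$, $\pi$ induces the probability measure $P_x^{\pi,\omega}$ (expectation $E_x^{\pi,\omega}$) on paths $(x_0,\ldots,x_n)\in\mathbb{Z}^{n+1}$ with $x_0=x$ and $z_{i+1}=x_{i+1}-x_i\in\{-1,1\}$ by $P_x^{\pi,\omega}(X_0=x_0,\ldots,X_n=x_n)=\prod_{i=0}^{n-1}\pi_i(n,\omega,x_i,z_{i+1})$. Define $$u(n,x,\omega\,|\,\delta,\beta,\theta)=\inf_{\pi\in\mathcal{P}_n(\delta)}\log E_x^{\pi,\omega}\left[e^{\beta\sum_{i=0}^{n-1}V(T_{X_i}\omega)+\theta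 X_n}\right].$$ *)

(* Defs.v *)
(* MathComp / MathComp-Analysis *)
From mathcomp Require Export all_boot all_order all_algebra.
From mathcomp Require Export all_classical all_reals all_analysis.
From mathcomp Require Export ess_sup_inf.
Export Order.TTheory GRing.Theory Num.Theory.
Export numFieldNormedType.Exports.

Set Implicit Arguments.
Unset Strict Implicit.
Unset Printing Implicit Defensive.

Local Open Scope classical_set_scope.
Local Open Scope ring_scope.

Definition measure_preserving d (Omega : measurableType d) (R : realType)
    (P : probability Omega R) (T : Omega -> Omega) : Prop :=
  measurable_fun setT T /\
  forall A : set Omega, measurable A -> P (T @^-1` A) = P A.

Definition ergodic d (Omega : measurableType d) (R : realType)
    (P : probability Omega R) (T : Omega -> Omega) : Prop :=
  forall A : set Omega, measurable A -> T @^-1` A = A ->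
    P A = 0%E \/ P A = 1%E.

(* T_k for k : int, where Tinv is the inverse of T; Negz n is the integer
   - n.+1. *)
Definition iterz (Omega : Type) (T Tinv : Omega -> Omega) (k : int) :
    Omega -> Omega :=
  match k with
  | Posz n => iter n T
  | Negz n => iter n.+1 Tinv
  end.

(* A step z in {-1, 1} is encoded by a boolean. *)
Definition step (z : bool) : int := if z then 1 else -1.

(* pi i w y z is the probability, used at time i, of making step z from
   position y in the environment w. *)
Definition policy (n : nat) (Omega : Type) (R : Type) :=
  'I_n -> Omega -> int -> bool -> R.

Definition policies d (Omega : measurableType d) (R : realType) (n : nat)
    (delta : R) : set (policy n Omega R) :=
  [set pi : policy n Omega R |
    (forall i y z, measurable_fun setT (fun w => pi i w y z)) /\
    (forall i w y,
      [/\ forall z, 0 <= pi i w y z <= 1,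
          pi i w y false + pi i w y true = 1 &
          `|pi i w y true - pi i w y false| <= delta])].

(* A nearest-neighbor path (x_0, ..., x_n) with x_0 = x is encoded by its
   sequence of steps z; walk x z i is x_i for i <= n. *)
Definition walk (n : nat) (x : int) (z : {ffun 'I_n -> bool}) (i : nat) : int :=
  x + \sum_(j < n | (j < i)%N) step (z j).

Definition path_prob (n : nat) (Omega : Type) (R : realType)
    (pi : policy n Omega R) (w : Omega) (x : int) (z : {ffun 'I_n -> bool}) : R :=
  \prod_(i < n) pi i w (walk x z i) (z i).

Definition path_expectation (n : nat) (Omega : Type) (R : realType)
    (pi : policy n Omega R) (w : Omega) (x : int)
    (f : {ffun 'I_n -> bool} -> R) : R :=
  \sum_(z : {ffun 'I_n -> bool}) path_prob pi w x z * f z.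

(* For 0 <= delta the infimum is that of a nonempty set of reals (the constant
   policy 1/2 belongs to it) which is bounded, since the exponent is bounded
   uniformly in the path; hence the real-valued inf is the true infimum. *)
Definition value d (Omega : measurableType d) (R : realType)
    (T Tinv : Omega -> Omega) (V : Omega -> R)
    (n : nat) (x : int) (w : Omega) (delta beta theta : R) : R :=
  inf [set ln (path_expectation pi w x (fun z =>
         expR (beta * (\sum_(i < n) V (iterz T Tinv (walk x z i) w))
               + theta * (walk x z n)%:~R)))
      | pi in @policies d Omega R n delta].

(* Num.truncn coincides with the floor on nonnegative reals; here it is applied
   with t, eps > 0. *)
Definition rescaled_value d (Omega : measurableType d) (R : realType)
    (T Tinv : Omega -> Omega) (V : Omega -> R)
    (t x : R) (w : Omega) (delta beta theta eps : R) : R :=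
  eps * value T Tinv V (Num.truncn (eps^-1 * t)) (Num.floor (eps^-1 * x)) w
          delta beta theta.

(* The library's lim is meaningful only together with the convergence of
   rescaled_value at 0^'+. *)
Definition limit_value d (Omega : measurableType d) (R : realType)
    (T Tinv : Omega -> Omega) (V : Omega -> R)
    (t x : R) (w : Omega) (delta beta theta : R) : R :=
  lim (rescaled_value T Tinv V t x w delta beta theta eps @[eps --> 0^'+]).

Definition effective_hamiltonian d (Omega : measurableType d) (R : realType)
    (T Tinv : Omega -> Omega) (V : Omega -> R)
    (w : Omega) (delta beta theta : R) : R :=
  limit_value T Tinv V 1 0 w delta beta theta.

(* Main.v *)
(* Since delta = 1, a policy may follow any given path deterministically, so the
   value at w is the minimum over nearest-neighbor paths of
   beta * \sum_i V (T_{x_i} w) + theta * x_n. Write v y = V (T_y w) and mu = E[V].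
   By the ergodic theorem for T and for its inverse, a two-sided primitive of v
   grows like mu * y. A path of displacement D visits every site between its end
   points, hence costs at least (beta * mu - |theta|) * |D| up to o(n); as
   |D| <= n, this is at least n * min(0, beta * mu - |theta|). The bound is
   attained either by walking straight in the direction of - theta, or by waiting
   on two neighboring sites where v is small; such sites have positive density,
   and so are found at distance o(n) of the starting point.
   The ergodic theorem for bounded functions is obtained from the covering
   argument of Kamae and Keane: if the sums of f exceed a * n without bound, then
   almost every orbit splits into bounded blocks with average at least a, which
   forces a <= E[f]. *)
Require Import Defs.
From mathcomp Require Import ring lra zify measurable_realfun.

Set Implicit Arguments.
Unset Strict Implicit.
Unset Printing Implicit Defensive.

Local Open Scope classical_set_scope.
Local Open Scope ring_scope.

(** * The ergodic theorem *)

Definition orbit_sum (R : realType) (X : Type) (T : X -> X) (f : X -> R)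
  (n : nat) (w : X) : R := \sum_(k < n) f (iter k T w).

Lemma orbit_sum_shift (R : realType) (X : Type) (T : X -> X) (f : X -> R) n w :
  orbit_sum T f n.+1 w = f w + orbit_sum T f n (T w).
Proof.
rewrite /orbit_sum big_ord_recl /=; congr (_ + _).
by apply: eq_bigr => i _; rewrite -iterSr.
Qed.

(** Blocks are removed one by one from the front, which is why [k] stays general in the induction.
    The leftover piece has length at most [M]; [0 <= g] lets it be dropped, at a cost of at most
    [a * M]. *)
Lemma sum_ge_of_short_blocks (R : realType) (g : nat -> R) (a : R) (M : nat) :
  0 <= a -> (forall k, 0 <= g k) ->
  (forall k, exists n, (0 < n <= M)%N /\
     a * n%:R <= \sum_(j < n) g (k + j)%N) ->
  forall n k, a * (n%:R - M%:R) <= \sum_(j < n) g (k + j)%N.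
Proof.
move=> a0 g0 blocks; elim/ltn_ind => n IH k.
case: (leqP n M) => [nM|Mn].
  apply: (@le_trans _ _ 0); last exact: sumr_ge0.
  by rewrite mulr_ge0_le0 // subr_le0 ler_nat.
have [n1 [/andP[n1_gt0 n1M] sum_n1]] := blocks k.
have [r def_n] : exists r, n = (n1 + r)%N by exists (n - n1)%N; lia.
subst n; have {}IH := IH r ltac:(lia) (k + n1)%N.
rewrite big_split_ord /=; under [X in _ <= _ + X]eq_bigr do rewrite addnA.
by apply: le_trans (lerD sum_n1 IH); rewrite natrD; lra.
Qed.

Section ergodic_theorem.
Variables (R : realType) (d : measure_display) (Omega : measurableType d).
Variables (P : probability Omega R) (T : Omega -> Omega).
Hypothesis T_mp : measure_preserving P T.

Lemma measurable_fun_iter n : measurable_fun setT (iter n T).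
Proof.
elim: n => [|n IH]; first exact: measurable_id.
by apply: (measurableT_comp _ IH); case: T_mp.
Qed.

Lemma measurable_orbit_sum (f : Omega -> R) n :
  measurable_fun setT f -> measurable_fun setT (orbit_sum T f n).
Proof.
move=> mf; apply: (@measurable_sum _ _ _ _ _ _
  (fun (k : 'I_n) w => f (iter k T w))) => k.
exact: (measurableT_comp mf (measurable_fun_iter k)).
Qed.

Lemma measurable_ler_cst (f : Omega -> R) (c : R) :
  measurable_fun setT f -> measurable [set w | c <= f w].
Proof.
move=> mf; rewrite (_ : [set w | _] = setT `&` f @^-1` `[c, +oo[%classic).
  exact: mf.
by rewrite setTI; apply/seteqP; split=> w /=; rewrite in_itv /= andbT.
Qed.

Lemma integral_iter (g : Omega -> R) n : measurable_fun setT g ->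
  (forall w, 0 <= g w) ->
  (\int[P]_w (g (iter n T w))%:E = \int[P]_w (g w)%:E)%E.
Proof.
move=> mg g0; elim: n => //= n <-.
have mgn : measurable_fun setT (EFin \o (g \o iter n T)).
  apply/measurable_EFinP.
  exact: (measurableT_comp mg (measurable_fun_iter n)).
have [mT PT] := T_mp.
under eq_integral do rewrite -iterS iterSr.
transitivity (\int[pushforward P T]_w (g (iter n T w))%:E)%E.
  rewrite ge0_integral_pushforward // => w _.
  by rewrite lee_fin.
by apply: eq_measure_integral => A mA _; exact: PT.
Qed.

Lemma integral_orbit_sum (g : Omega -> R) (m : R) n :
  measurable_fun setT g -> (forall w, 0 <= g w) ->
  (\int[P]_w (g w)%:E = m%:E)%E ->
  (\int[P]_w (orbit_sum T g n w)%:E = (n%:R * m)%:E)%E.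
Proof.
move=> mg g0 gm; under eq_integral do rewrite /orbit_sum -sumEFin.
rewrite (@ge0_integral_sum _ _ _ P setT measurableT _
  (fun (k : 'I_n) w => (g (iter k T w))%:E)) //; last first.
- by move=> k w _; rewrite lee_fin.
- move=> k; apply/measurable_EFinP.
  exact: (measurableT_comp mg (measurable_fun_iter k)).
under eq_bigr do rewrite integral_iter // gm.
by rewrite sumEFin sumr_const card_ord mulr_natl.
Qed.

(* Asking for an unbounded excess, rather than for limsup S_n / n >= a, makes
   this set exactly invariant when f is bounded. *)
Definition unbounded_excess (f : Omega -> R) (a : R) : set Omega :=
  [set w | forall C : nat, exists n, a * n%:R + C%:R <= orbit_sum T f n w].

Lemma measurable_unbounded_excess f a : measurable_fun setT f ->
  measurable (unbounded_excess f a).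
Proof.
move=> mf; rewrite (_ : unbounded_excess f a = \bigcap_C \bigcup_n
  [set w | a * n%:R + C%:R <= orbit_sum T f n w]).
  apply: bigcapT_measurable => C; apply: bigcupT_measurable => n.
  exact/measurable_ler_cst/measurable_orbit_sum.
apply/seteqP; split=> w /= aw C; first by move=> _; have [n ?] := aw C; exists n.
by have [n _ ?] := aw C I; exists n.
Qed.

(** Passing from [w] to [T w] changes the two sides by a bounded amount, which the arbitrary
    constant [C] absorbs. *)
Lemma unbounded_excess_invariant f a : (forall w, 0 <= f w <= 1) ->
  T @^-1` unbounded_excess f a = unbounded_excess f a.
Proof.
move=> f01; have aA : `|a| <= (Num.truncn `|a|).+1%:R.
  by apply/ltW; apply: truncnS_gt.
set A := (Num.truncn `|a|).+1 in aA; move: aA; rewrite ler_norml => /andP[Aa aA].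
apply/seteqP; split=> w /= aw C.
  have [n an] := aw (C + A)%N; exists n.+1.
  rewrite orbit_sum_shift; have := f01 w; move: an; rewrite natrD -natr1; lra.
(* The extra unit excludes [n = 0], where the sum is empty, and pays for the lost first term
   [f w <= 1]. *)
have [[|n] an] := aw (C + A).+1.
  by move: an; rewrite /orbit_sum big_ord0 mulr0 add0r lern0.
exists n; move: an (f01 w); rewrite orbit_sum_shift -!natr1 natrD; lra.
Qed.

Definition returns_within (f : Omega -> R) (a : R) (M : nat) : set Omega :=
  \bigcup_(n in [set n | (0 < n <= M)%N])
    [set w | a * n%:R <= orbit_sum T f n w].

Lemma measurable_returns_within f a M : measurable_fun setT f ->
  measurable (returns_within f a M).
Proof.
move=> mf; apply: bigcup_measurable => n _.
exact/measurable_ler_cst/measurable_orbit_sum.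
Qed.

(* Adding a on the event that no return occurs within M steps cuts every orbit
   into blocks of length at most M along which the average is at least a. *)
Lemma le_mean_of_returns (f : Omega -> R) (a m p : R) M : (0 < M)%N ->
  measurable_fun setT f ->
  (forall w, 0 <= f w) -> 0 <= a -> (\int[P]_w (f w)%:E = m%:E)%E ->
  P (~` returns_within f a M) = p%:E -> a <= m + a * p.
Proof.
move=> M_gt0 mf f0 a0 fm Ep.
have mE : measurable (~` returns_within f a M).
  exact/measurableC/measurable_returns_within.
pose g w := f w + a * \1_(~` returns_within f a M) w.
have mh : measurable_fun setT (fun w => a * \1_(~` returns_within f a M) w).
  by apply: measurable_funM => //; apply: measurable_indic.
have h0 w : 0 <= a * \1_(~` returns_within f a M) w by rewrite mulr_ge0.
have mg : measurable_fun setT g by exact: measurable_funD.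
have g0 w : 0 <= g w by rewrite addr_ge0.
have gE : (\int[P]_w (g w)%:E = (m + a * p)%:E)%E.
  under eq_integral do rewrite /g EFinD.
  rewrite ge0_integralD //; last 4 first.
  - by move=> w _; rewrite lee_fin.
  - exact/measurable_EFinP.
  - by move=> w _; rewrite lee_fin.
  - exact/measurable_EFinP.
  rewrite fm; under eq_integral do rewrite EFinM.
  rewrite ge0_integralZl_EFin //; last first.
    by apply/measurable_EFinP; apply: measurable_indic.
  rewrite integral_indic // setIT EFinD EFinM.
  by congr (_ + _ * _)%E; exact: Ep.
have key n : a * (n%:R - M%:R) <= n%:R * (m + a * p).
  rewrite -lee_fin -(integral_orbit_sum n mg g0 gE).
  (* Comparing integrals below requires a nonnegative left-hand side; when it is not positive, the
     bound is immediate. *)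
  case: (leP n%:R (M%:R : R)) => [nM|Mn].
    apply: (@le_trans _ _ 0%E).
      by rewrite lee_fin mulr_ge0_le0 // subr_le0.
    by apply: integral_ge0 => w _; rewrite lee_fin; apply: sumr_ge0.
  rewrite -[leLHS]mule1 -(@probability_setT _ _ _ P) -integral_cst //.
  apply: ge0_le_integral => //.
  - by move=> w _; rewrite lee_fin mulr_ge0 // subr_ge0 ltW.
  - exact/measurable_EFinP/measurable_orbit_sum.
  move=> w _; rewrite lee_fin.
  apply: (@sum_ge_of_short_blocks _ (fun k => g (iter k T w)) a M a0 _ _ n 0%N) => [k|k] //.
  have [Ew|nEw] := pselect (returns_within f a M (iter k T w)).
    case: Ew => r /= rM ar; exists r; split=> //.
    apply: le_trans ar _; apply: ler_sum => j _.
    by rewrite addnC iterD lerDl.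
  exists 1%N; split=> //; rewrite big_ord1 mulr1 addn0 /g indicE mem_set //.
  by rewrite mulr1 lerDr.
(* Otherwise [key] would bound every [n] by [a * M / (a - (m + a * p))]. *)
rewrite leNgt; apply/negP => ma.
have := truncnS_gt (a * M%:R / (a - (m + a * p))).
by rewrite ltr_pdivrMr ?subr_gt0 //; have := key (Num.truncn
  (a * M%:R / (a - (m + a * p)))).+1; lra.
Qed.

(** A point of unbounded excess returns within some [M], so the probability [p] of no return within
    [M] steps tends to 0, and [a <= m + a * p] passes to the limit. *)
Lemma unbounded_excess_le_mean (f : Omega -> R) (a m : R) :
  measurable_fun setT f -> (forall w, 0 <= f w) -> 0 <= a ->
  (\int[P]_w (f w)%:E = m%:E)%E -> P (unbounded_excess f a) = 1%E -> a <= m.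
Proof.
move=> mf f0 a0 fm PB1.
pose E M := returns_within f a M.+1.
have mE M : measurable (E M) by exact: measurable_returns_within.
have mEU : measurable (\bigcup_M E M) by exact: bigcupT_measurable.
have PEU : P (\bigcup_M E M) = 1%E.
  apply/eqP; rewrite eq_le probability_le1 //= -PB1 le_measure ?inE //.
    exact: measurable_unbounded_excess.
  (* An excess of 1 rules out the empty sum. *)
  move=> w /(_ 1%N) [[|n]]; rewrite /= ?mulr0 ?add0r.
    by rewrite /orbit_sum big_ord0 lern0.
  move=> an; exists n => //; exists n.+1 => //=.
  by apply: le_trans an; rewrite lerDl.
have cvE : P (E M) @[M --> \oo] --> 1%E.
  rewrite -PEU; apply: nondecreasing_cvg_mu => // M N MN.
  apply/subsetPset => w [n /= /andP[n0 nM] an]; exists n => //=.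
  by rewrite n0 (leq_trans nM).
have cvE' : fine (P (E M)) @[M --> \oo] --> (1 : R).
  exact: (@fine_cvg _ _ _ _ (fun M => P (E M)) 1).
have : a <= m + a * (1 - 1).
  suff cvR : m + a * (1 - fine (P (E M))) @[M --> \oo] --> m + a * (1 - 1).
    apply: (cvgr_to_ge cvR); apply: nearW => M.
    apply: (le_mean_of_returns (ltn0Sn M) mf f0 a0 fm).
    rewrite (probability_setC P (mE M)) -[in LHS](fineK (x := P (E M))) //.
    by rewrite fin_num_measure.
  by apply: cvgD; [exact: cvg_cst|]; apply: cvgMr; apply: cvgB => //;
    exact: cvg_cst.
by rewrite subrr mulr0 addr0.
Qed.

(** The set of unbounded excess is invariant, hence of probability 0 or 1, and probability 1 would
    force [a <= m]. *)
Lemma ergodic_sum_upper (f : Omega -> R) (a m : R) : ergodic P T ->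
  measurable_fun setT f -> (forall w, 0 <= f w <= 1) ->
  (\int[P]_w (f w)%:E = m%:E)%E -> m < a ->
  {ae P, forall w, exists C : nat, forall n, orbit_sum T f n w <= a * n%:R + C%:R}.
Proof.
move=> T_erg mf f01 fm ma.
have f0 w : 0 <= f w by case/andP: (f01 w).
have m0 : 0 <= m by rewrite -lee_fin -fm integral_ge0 // => w _; rewrite lee_fin.
have mB : measurable (unbounded_excess f a) by exact: measurable_unbounded_excess.
have [PB0|PB1] := T_erg _ mB (unbounded_excess_invariant a f01).
  exists (unbounded_excess f a); split=> // w /= nC C.
  apply/not_existsP => nn; apply: nC; exists C => n.
  by have /negP := nn n; rewrite -ltNge => /ltW.
have := unbounded_excess_le_mean mf f0 (le_trans m0 (ltW ma)) fm PB1.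
by rewrite leNgt ma.
Qed.

(** The lower bound is the upper bound for [1 - f]. Each rate has its own null set, so only the
    rates [k.+1%:R^-1] are used and countably many null sets are discarded. *)
Lemma ergodic_sum (f : Omega -> R) (m : R) : ergodic P T ->
  measurable_fun setT f -> (forall w, 0 <= f w <= 1) ->
  (\int[P]_w (f w)%:E = m%:E)%E ->
  {ae P, forall w, forall eta : R, 0 < eta -> exists C : nat, forall n,
    `|orbit_sum T f n w - m * n%:R| <= eta * n%:R + C%:R}.
Proof.
move=> T_erg mf f01 fm.
pose f' w := 1 - f w.
have mf' : measurable_fun setT f' by exact: measurable_funB.
have f'01 w : 0 <= f' w <= 1 by rewrite /f'; have := f01 w; lra.
have f'm : (\int[P]_w (f' w)%:E = (1 - m)%:E)%E.
  have : (\int[P]_w (f w + f' w)%:E = 1)%E.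
    under eq_integral do rewrite /f' addrC subrK.
    by rewrite integral_cst // mul1e; exact: probability_setT.
  under eq_integral do rewrite EFinD.
  rewrite ge0_integralD //; last 4 first.
  - by move=> w _; rewrite lee_fin; case/andP: (f01 w).
  - exact/measurable_EFinP.
  - by move=> w _; rewrite lee_fin; case/andP: (f'01 w).
  - exact/measurable_EFinP.
  rewrite fm; case: (integral _ _ _) => //= r [] <-.
  by congr EFin; lra.
have upper k := ergodic_sum_upper T_erg mf f01 fm
  (ltr_pwDr (harmonic_gt0 k) (lexx m)).
have lower k := ergodic_sum_upper T_erg mf' f'01 f'm
  (ltr_pwDr (harmonic_gt0 k) (lexx (1 - m))).
have both k : {ae P, forall w, exists C : nat, forall n,
    `|orbit_sum T f n w - m * n%:R| <= k.+1%:R^-1 * n%:R + C%:R}.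
  have := upper k; apply: filterS2 (lower k) => w [C1 C1w] [C2 C2w].
  exists (maxn C1 C2) => n.
  have C1M : C1%:R <= (maxn C1 C2)%:R :> R by rewrite ler_nat leq_maxl.
  have C2M : C2%:R <= (maxn C1 C2)%:R :> R by rewrite ler_nat leq_maxr.
  have := C1w n; have := C2w n; rewrite /harmonic /=.
  have -> : orbit_sum T f' n w = n%:R - orbit_sum T f n w.
    by rewrite /orbit_sum sumrB sumr_const card_ord.
  rewrite ler_norml !mulrDl mulNr mul1r; move: (k.+1%:R^-1 * n%:R) (m * n%:R) => ? ? ? ?.
  by apply/andP; split; lra.
apply: filterS (ae_foralln both) => w bw eta eta0.
have [C Cw] := bw (Num.truncn eta^-1); exists C => n.
apply: le_trans (Cw n) _; rewrite lerD2r ler_wpM2r //.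
by rewrite invf_ple ?posrE // ltW // truncnS_gt.
Qed.

End ergodic_theorem.

(** * Optimal control by deterministic paths *)

Section control.
Variables (R : realType) (d : measure_display) (Omega : measurableType d).

(** The last step is summed out first: the factors of the earlier steps do not depend on it, and its
    own two probabilities add up to 1. *)
Lemma sum_path_prob n (pi : policy n Omega R) w x :
  (forall i y, pi i w y false + pi i w y true = 1) ->
  \sum_(z : {ffun 'I_n -> bool}) path_prob pi w x z = 1.
Proof.
elim: n pi => [|n IH] pi pi1.
  rewrite /path_prob; under eq_bigr do rewrite big_ord0.
  by rewrite sumr_const card_ffun card_ord expn0.
pose ext (p : {ffun 'I_n -> bool} * bool) : {ffun 'I_n.+1 -> bool} :=
  [ffun i => if unlift ord_max i is Some j then p.1 j else p.2].
have extW p j : ext p (widen_ord (leqnSn n) j) = p.1 j.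
  rewrite ffunE (_ : widen_ord _ j = lift ord_max j) ?liftK //.
  by apply: val_inj; rewrite /= /bump leqNgt ltn_ord.
have extM p : ext p ord_max = p.2 by rewrite ffunE unlift_none.
have ext_bij : bijective ext.
  exists (fun z : {ffun 'I_n.+1 -> bool} =>
    ([ffun j => z (widen_ord (leqnSn n) j)], z ord_max)).
    by move=> [z b]; rewrite extM; congr pair; apply/ffunP => j; rewrite ffunE extW.
  move=> z; apply/ffunP => i; case: (unliftP ord_max i) => [j|] ->.
    rewrite (_ : lift ord_max j = widen_ord (leqnSn n) j) ?extW ?ffunE //.
    by apply: val_inj; rewrite /= /bump leqNgt ltn_ord.
  by rewrite extM.
rewrite (reindex ext) /=; last exact: onW_bij.
rewrite -(pair_bigA _ (fun z b => path_prob pi w x (ext (z, b)))) /=.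
have walkW z b i : (i <= n)%N -> walk x (ext (z, b)) i = walk x z i.
  move=> le_in; rewrite /walk big_mkcond big_ord_recr /= ltnNge le_in addr0.
  by rewrite [in RHS]big_mkcond; congr (_ + _); apply: eq_bigr => j _; rewrite extW.
rewrite -[RHS](IH (fun i => pi (widen_ord (leqnSn n) i))) //.
apply: eq_bigr => z _; rewrite big_bool /=.
rewrite /path_prob !big_ord_recr /= !extM /= !walkW //.
have E b : \prod_(i < n) pi (widen_ord (leqnSn n) i) w
     (walk x (ext (z, b)) i) (ext (z, b) (widen_ord (leqnSn n) i)) =
   \prod_(i < n) pi (widen_ord (leqnSn n) i) w (walk x z i) (z i).
  by apply: eq_bigr => i _; rewrite extW walkW // ltnW.
by rewrite !E -mulrDr addrC pi1 mulr1.
Qed.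

(** An average over paths cannot beat the cheapest path, whatever [delta] is. *)
Lemma ln_path_expectation_ge n (delta : R) (pi : policy n Omega R) w x f (L : R) :
  policies delta pi -> (forall z, L <= f z) ->
  L <= ln (path_expectation pi w x (fun z => expR (f z))).
Proof.
move=> [_ pi_spec] Lf.
have pi0 z : 0 <= path_prob pi w x z.
  by apply: prodr_ge0 => i _; have [/(_ (z i))/andP[]] := pi_spec i w (walk x z i).
have expR_le : expR L <= path_expectation pi w x (fun z => expR (f z)).
  rewrite -[leLHS]mul1r -(@sum_path_prob n pi w x) ?mulr_suml.
    by apply: ler_sum => z _; rewrite ler_wpM2l // ler_expR.
  by move=> i y; case: (pi_spec i w y).
rewrite -[leLHS]expRK ler_ln ?posrE ?expR_gt0 //.
exact: lt_le_trans (expR_gt0 L) expR_le.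
Qed.

(* Policies that ignore w are trivially measurable in w, so the path that is
   optimal for a given w may be followed without any measurable selection. *)
Definition open_loop n (z0 : {ffun 'I_n -> bool}) : policy n Omega R :=
  fun i _ _ b => (b == z0 i)%:R.

Lemma open_loop_policies n (z0 : {ffun 'I_n -> bool}) :
  policies 1 (open_loop z0).
Proof.
split=> [i y z|i w y]; first exact: measurable_cst.
rewrite /open_loop; split=> [z||].
- by case: eqP; rewrite ?lexx ?ler01.
- by case: (z0 i); rewrite /= ?addr0 ?add0r.
- by case: (z0 i); rewrite /= ?subr0 ?sub0r ?normrN normr1.
Qed.

Lemma open_loop_expectation n (z0 : {ffun 'I_n -> bool}) w x f :
  path_expectation (open_loop z0) w x f = f z0.
Proof.
have prob z : path_prob (open_loop z0) w x z = (z == z0)%:R.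
  have [->|] := eqVneq z z0.
    by rewrite /path_prob big1 // => i _; rewrite /open_loop eqxx.
  move=> /eqP zz0; have [i zi] : exists i, z i != z0 i.
    apply/existsP; rewrite -negb_forall; apply/negP => /forallP zz.
    by apply: zz0; apply/ffunP => i; apply/eqP.
  by rewrite /path_prob (bigD1 i) //= /open_loop (negbTE zi) mul0r.
rewrite /path_expectation (bigD1 z0) //= prob eqxx mul1r big1 ?addr0 // => z zz0.
by rewrite prob (negbTE zz0) mul0r.
Qed.

Variables (T Tinv : Omega -> Omega) (V : Omega -> R) (beta theta : R).

Definition path_cost n (x : int) (w : Omega) (z : {ffun 'I_n -> bool}) : R :=
  beta * (\sum_(i < n) V (iterz T Tinv (walk x z i) w))
    + theta * (walk x z n)%:~R.

Lemma value_ge n x w (L : R) : (forall z, L <= path_cost (n := n) x w z) ->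
  L <= value T Tinv V n x w 1 beta theta.
Proof.
move=> Lz; apply: lb_le_inf.
  (* A member is exhibited because [inf] is a true infimum only for a nonempty set. *)
  exists (ln (path_expectation (open_loop [ffun=> true]) w x (fun z =>
    expR (path_cost (n := n) x w z)))).
  by exists (open_loop [ffun=> true]) => //; exact: open_loop_policies.
by move=> _ [pi pi_ok <-]; exact: ln_path_expectation_ge pi_ok Lz.
Qed.

Lemma value_le n x w z : value T Tinv V n x w 1 beta theta <= path_cost (n := n) x w z.
Proof.
apply: ge_inf.
  (* Likewise [inf] lies below the members only if the set is bounded below; this crude bound lies
     below the cost of every path. *)
  exists (- \sum_z `|path_cost (n := n) x w z|) => _ [pi pi_ok <-].
  apply: ln_path_expectation_ge pi_ok _ => z'.
  have := lerNnormlW (lexx `|path_cost x w z'|); apply: le_trans.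
  by rewrite lerN2 (bigD1 z') //= lerDl sumr_ge0.
exists (open_loop z); first exact: open_loop_policies.
by rewrite open_loop_expectation expRK.
Qed.

Lemma walk0 n x (z : {ffun 'I_n -> bool}) : walk x z 0 = x.
Proof. by rewrite /walk big1 ?addr0. Qed.

Lemma walkS n x (z : {ffun 'I_n -> bool}) (i : 'I_n) :
  walk x z i.+1 = walk x z i + step (z i).
Proof.
rewrite /walk -addrA; congr (_ + _).
rewrite (bigD1 i) ?ltnSn //= addrC; congr (_ + _).
by apply: eq_bigl => j; rewrite ltnS [in RHS]ltn_neqAle andbC.
Qed.

(** Allows a path to be given by a formula for its positions, the steps being read off from the
    increments. *)
Lemma value_le_path n (X : nat -> int) w :
  (forall i, X i.+1 = X i + 1 \/ X i.+1 = X i - 1) ->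
  value T Tinv V n (X 0%N) w 1 beta theta <=
  beta * (\sum_(i < n) V (iterz T Tinv (X i) w)) + theta * (X n)%:~R.
Proof.
move=> XS; pose z := [ffun i : 'I_n => X i.+1 == X i + 1].
have walkX i : (i <= n)%N -> walk (X 0%N) z i = X i.
  elim: i => [|i IH] lt_in; first exact: walk0.
  rewrite (walkS _ _ (Ordinal lt_in)) /= IH ?(ltnW lt_in) // ffunE /=.
  by rewrite /step; case: eqP => [->//|]; case: (XS i) => ->.
rewrite (le_trans (value_le (X 0%N) w z)) // /path_cost walkX // lerD2r.
by under eq_bigr => i _ do rewrite walkX ?(ltnW (ltn_ord i)) //.
Qed.

End control.

(** * Two-sided sums along an orbit *)

Section primitives.
Variable R : realType.

(** The discrete antiderivative of [v] vanishing at 0; since [Negz n] is [- n.+1], the negative side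
    has [n.+1] terms. *)
Definition primitive (v : int -> R) (y : int) : R :=
  match y with
  | Posz n => \sum_(k < n) v k%:Z
  | Negz n => - \sum_(k < n.+1) v (Negz k)
  end.

Lemma primitiveS v y : primitive v (y + 1) = primitive v y + v y.
Proof.
case: y => [n|[|n]].
- by rewrite (_ : Posz n + 1 = n.+1%:Z) /= ?big_ord_recr //; lia.
- by rewrite /= big_ord0 big_ord1 addNr.
rewrite (_ : Negz n.+1 + 1 = Negz n); last by rewrite !NegzE; lia.
by rewrite /= [in RHS]big_ord_recr /= opprD addrNK.
Qed.

(** This amounts to [F y / y] tending to [m] at both infinities, in an additive form valid at every
    site. *)
Definition has_slope (F : int -> R) (m : R) := forall eta : R, 0 < eta ->
  exists C : R, forall y : int,
    `|F y - m * y%:~R| <= eta * `|y%:~R| + C.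

Definition nearest_neighbor (n : nat) (X : nat -> int) :=
  forall i, (i < n)%N -> X i.+1 = X i + 1 \/ X i.+1 = X i - 1.

Lemma nearest_neighbor_dist n X : nearest_neighbor n X ->
  `|(X n)%:~R - (X 0%N)%:~R : R| <= n%:R.
Proof.
elim: n => [|n IH] XS; first by rewrite subrr normr0.
have {}IH : `|(X n)%:~R - (X 0%N)%:~R : R| <= n%:R.
  by apply: IH => i lt_in; apply: XS; rewrite ltnW.
apply: le_trans (ler_distD (X n)%:~R _ _) _.
rewrite -natr1 addrC lerD //.
by case: (XS n (ltnSn n)) => ->; rewrite ?rmorphB ?rmorphD /= addrAC subrr
  add0r ?normrN normr1.
Qed.

(* The downward bound uses the primitive shifted by one, because a step from y
   to y - 1 collects v y, and not v (y - 1). *)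
Lemma sum_along_ge n X v : nearest_neighbor n X -> (forall y, 0 <= v y) ->
  primitive v (X n) - primitive v (X 0%N) <= \sum_(i < n) v (X i) /\
  primitive v (X 0%N + 1) - primitive v (X n + 1) <= \sum_(i < n) v (X i).
Proof.
move=> XS v0; elim: n XS => [|n IH] XS; first by rewrite big_ord0 !subrr.
have [|up down] := IH; first by move=> i lt_in; apply: XS; rewrite ltnW.
rewrite big_ord_recr /=; have := primitiveS v (X n); have := v0 (X n).
case: (XS n (ltnSn n)) => ->.
  have := primitiveS v (X n + 1); have := v0 (X n + 1).
  by split; lra.
have := primitiveS v (X n - 1); have := v0 (X n - 1).
by rewrite !subrK; split; lra.
Qed.

(** If [A] misses [J] consecutive sites from [x] on, the primitive is constant there, although its
    slope predicts a growth of [p * J] up to an error [e * (2 * |x| + J) + 2 * C]; this bounds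
    [J]. *)
Lemma hits_of_slope (A : int -> bool) (p : R) : 0 < p ->
  has_slope (primitive (fun y => (A y)%:R)) p -> forall eta : R, 0 < eta ->
  exists C : R, forall x : int, exists2 j : nat,
    j%:R <= eta * `|x%:~R| + C & A (x + j%:Z).
Proof.
move=> p0 slope eta eta0; set G := primitive _ in slope.
(* With [e <= p / 2] half of [p * J] survives the error in [J], so that
   [J <= 4 * (e * |x| + C) / p]; then [e <= p * (eta / 4)] gives the rate [eta]. *)
pose e := p * Num.min (1 / 2) (eta / 4).
have e0 : 0 < e by rewrite mulr_gt0 // lt_min !divr_gt0.
have e1 : e <= p / 2 by rewrite ler_pM2l // ge_min mul1r lexx.
have e2 : e <= p * (eta / 4) by rewrite ler_pM2l // ge_min lexx orbT.
have [C GC] := slope e e0.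
have C0 : 0 <= C.
  have := le_trans (normr_ge0 _) (GC 0).
  by rewrite mulr0z normr0 mulr0 add0r.
exists (4 * C / p) => x.
set b := eta * _ + _.
have b0 : 0 <= b by rewrite addr_ge0 ?mulr_ge0 ?invr_ge0 // ltW.
pose J := (Num.truncn b).+1.
apply/not_exists2P => miss.
have GJ i : (i <= J)%N -> G (x + i%:Z) = G x.
  elim: i => [|i IH] iJ; first by rewrite addr0.
  rewrite intS (addrC 1) addrA {1}/G primitiveS -/G IH ?(ltnW iJ) //.
  have [|/negP/negbTE ->] := miss i; last by rewrite addr0.
  by case; rewrite -truncn_ge_nat // -ltnS.
have := GC (x + J%:Z); have := GC x; rewrite GJ // rmorphD /=.
have bJ : b < J%:R by exact: truncnS_gt.
rewrite pmulrn in bJ *.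
have xJ := ler_normD (x%:~R : R) (J%:~R).
rewrite (ger0_norm (x := J%:~R)) ?ler0z // in xJ.
have ex : 0 <= `|x%:~R : R| by [].
have J0 : 0 <= J%:~R :> R by rewrite ler0z.
move: (J%:~R : R) bJ xJ J0 => K bK xK K0.
have h1 := ler_wpM2r K0 e1.
have h2 := ler_wpM2r ex e2.
have h3 := ler_wpM2l (ltW e0) xK.
have h4 : p * b < p * K by rewrite ltr_pM2l.
have h5 : p * b = p * eta * `|x%:~R| + 4 * C.
  by rewrite /b; field; lra.
rewrite !ler_norml => /andP[g1 g2] /andP[g3 g4]; nra.
Qed.

End primitives.

(** * Ergodic averages in both directions of time *)

Section two_sided.
Variables (R : realType) (d : measure_display) (Omega : measurableType d).
Variables (P : probability Omega R) (T Tinv : Omega -> Omega).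
Hypothesis TK : cancel T Tinv.
Hypotheses (mTinv : measurable_fun setT Tinv) (T_mp : measure_preserving P T).
Hypothesis T_erg : ergodic P T.

Lemma measure_preserving_inv : measure_preserving P Tinv.
Proof.
split=> // A mA; have [_ PT] := T_mp.
have mB : measurable (Tinv @^-1` A) by rewrite -[X in measurable X]setTI; exact: mTinv.
rewrite -(PT _ mB); congr (P _).
by apply/seteqP; split=> w /=; rewrite TK.
Qed.

Lemma ergodic_inv : ergodic P Tinv.
Proof.
move=> A mA AE; apply: T_erg => //; rewrite -{1}AE.
by apply/seteqP; split=> w /=; rewrite TK.
Qed.

Lemma ae_has_slope (f : Omega -> R) (m : R) : measurable_fun setT f ->
  (forall w, 0 <= f w <= 1) -> (\int[P]_w (f w)%:E = m%:E)%E ->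
  {ae P, forall w, has_slope (primitive (fun y => f (iterz T Tinv y w))) m}.
Proof.
move=> mf f01 fm.
have := ergodic_sum T_mp T_erg mf f01 fm.
apply: filterS2 (ergodic_sum measure_preserving_inv ergodic_inv mf f01 fm).
move=> w bwd fwd eta eta0.
have [C1 {}bwd] := bwd eta eta0; have [C2 {}fwd] := fwd eta eta0.
exists (C1%:R + C2%:R + eta + 1 + `|m|) => -[n|n].
  have := fwd n; rewrite /orbit_sum /= -pmulrn (ger0_norm (x := n%:R)) // => /le_trans; apply.
  have := normr_ge0 m; have := ler0n R C1; lra.
(* The primitive at [- n.+1] does not contain the site 0, so the first of [n.+2] terms is removed;
   this costs the [eta + 1 + |m|] in the constant. *)
have := bwd n.+2; rewrite orbit_sum_shift /=.
set S := orbit_sum _ _ _ _; rewrite (_ : \sum_(k < n.+1) _ = S); last first.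
  by apply: eq_bigr => k _; rewrite -iterSr.
rewrite NegzE rmorphN normrN /= -pmulrn (ger0_norm (x := n.+1%:R)) //.
rewrite -[n.+2%:R]natr1 !ler_norml => /andP[b1 b2].
have := f01 w => /andP[f0 f1].
have := ler_norm m; have := lerNnormlW (lexx `|m|).
have := ler0n R C2.
move: (n.+1%:R : R) b1 b2 => N b1 b2 ? ? ?; apply/andP; split; lra.
Qed.

End two_sided.

(** * Asymptotics of the value *)

Lemma sum_ltn_ord n j : (\sum_(i < n) (i < j) = minn n j)%N.
Proof.
elim: n => [|n IH]; first by rewrite big_ord0 min0n.
by rewrite big_ord_recr /= IH; case: (ltnP n j); lia.
Qed.

(* Go up j steps, then oscillate between the two sites reached. *)
Lemma wait_path_nearest_neighbor (x : int) (i j : nat)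
    (X := fun i => x + (minn i j + odd (i - j))%:Z) :
  X i.+1 = X i + 1 \/ X i.+1 = X i - 1.
Proof.
rewrite {}/X /=; case: (ltnP i j) => ij.
  left; rewrite (eqP (ltnW ij)) (eqP ij) (minn_idPl ij) /= !addn0 intS; ring.
rewrite subSn // (minn_idPr (leqW ij)) /=.
by case: (odd _); rewrite /= !PoszD; [right|left]; ring.
Qed.

Section value_asymptotics.
Variables (R : realType) (d : measure_display) (Omega : measurableType d).
Variables (T Tinv : Omega -> Omega) (V : Omega -> R) (beta theta : R).
Hypotheses (V01 : forall w, 0 <= V w <= 1) (beta_gt0 : 0 < beta).
Variables (w : Omega) (mu : R).

Local Notation v := (fun y => V (iterz T Tinv y w)).
Local Notation value n x := (value T Tinv V n x w 1 beta theta).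

Hypothesis v_slope : has_slope (primitive v) mu.

Lemma value_lower eta : 0 < eta -> exists C : R, forall n x,
  Num.min 0 (beta * mu - `|theta|) * n%:R + theta * x%:~R
    - (eta * (n%:R + `|x%:~R|) + C) <= value n x.
Proof.
(* The slope error occurs at both ends of the path and is multiplied by [beta], hence the divisor;
   the summand [eta] in the constant pays for the shift by one site in the downward bound. *)
move=> eta0; have e0 : 0 < eta / (2 * beta) by rewrite divr_gt0 // mulr_gt0.
have [C FC] := v_slope e0; exists (eta + 2 * beta * C) => n x.
apply: value_ge => z; rewrite /path_cost.
have nn : nearest_neighbor n (walk x z).
  move=> i lt_in; rewrite (walkS x z (Ordinal lt_in)) /= /step.
  by case: (z _); [left|right].
have [up down] := @sum_along_ge _ n _ v nn (fun y => proj1 (andP (V01 _))).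
have S0 : 0 <= \sum_(i < n) v (walk x z i).
  by apply: sumr_ge0 => i _; case/andP: (V01 (iterz T Tinv (walk x z i) w)).
have := nearest_neighbor_dist R nn.
rewrite walk0 in up down *.
move: (walk x z n) up down => y up down.
have := FC (y + 1); have := FC y.
have := FC (x + 1); have := FC x.
move: (\sum_(i < n) _) S0 up down => S S0 up down.
rewrite !rmorphD /= !mulr1z; move: (n%:R : R) (ler0n R n) => N N0.
move: (y%:~R : R) (x%:~R : R) => Y X b1 b2 b3 b4 XY.
set e := eta / _ in e0 b1 b2 b3 b4.
have be : beta * e = eta / 2 by rewrite /e; field; rewrite gt_eqF.
have nY : `|Y| <= `|X| + N.
  by have := ler_normD (Y - X) X; rewrite subrK; lra.
have nX1 : `|X + 1| <= `|X| + 1 by have := ler_normD X 1; rewrite normr1.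
have nY1 : `|Y + 1| <= `|X| + N + 1.
  by have := ler_normD Y 1; rewrite normr1; lra.
have eY := ler_wpM2l (ltW e0) nY; have eX1 := ler_wpM2l (ltW e0) nX1.
have eY1 := ler_wpM2l (ltW e0) nY1.
move: b1 b2 b3 b4; rewrite !ler_norml.
move=> /andP[b1 b1'] /andP[b2 b2'] /andP[b3 b3'] /andP[b4 b4'].
pose E := e * (2 * `|X| + N + 2) + 2 * C.
have Sup : mu * (Y - X) - E <= S by rewrite /E; lra.
have Sdown : - mu * (Y - X) - E <= S by rewrite /E; lra.
have bE : beta * E <= eta * (N + `|X|) + (eta + 2 * beta * C).
  rewrite /E mulrDr (mulrA beta e) be.
  by have := mulr_ge0 (ltW eta0) N0; lra.
have bSup := ler_wpM2l (ltW beta_gt0) Sup.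
have bSdown := ler_wpM2l (ltW beta_gt0) Sdown.
set M := Num.min _ _.
have M0 : M <= 0 by rewrite ge_min lexx.
have Mle : M <= beta * mu - `|theta| by rewrite ge_min lexx orbT.
have := ler_norm theta; have := lerNnormlW (lexx `|theta|) => t1 t2.
move: XY; rewrite ler_norml => /andP[D1 D2].
(* As [M <= 0] and the displacement is at most [N] in absolute value, [M * N] is below [M] times
   that absolute value; its sign selects [Sup] or [Sdown]. *)
case: (leP 0 (Y - X)) => D0.
  have s1 : M * N <= M * (Y - X) by rewrite ler_wnM2l.
  have s2 : M * (Y - X) <= (beta * mu + theta) * (Y - X).
    by rewrite ler_wpM2r //; lra.
  lra.
have s1 : M * N <= M * (X - Y) by rewrite ler_wnM2l //; lra.
have s2 : M * (X - Y) <= (beta * mu - theta) * (X - Y).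
  by rewrite ler_wpM2r //; lra.
lra.
Qed.

(** The upward straight walk collects an increment of the primitive; it serves the case
    [theta < 0]. *)
Lemma value_upper_up eta : 0 < eta -> exists C : R, forall n x,
  value n x <= (beta * mu + theta) * n%:R + theta * x%:~R
    + (eta * (n%:R + `|x%:~R|) + C).
Proof.
move=> eta0; have e0 : 0 < eta / (2 * beta) by rewrite divr_gt0 // mulr_gt0.
have [C FC] := v_slope e0; exists (2 * beta * C) => n x.
have := @value_le_path _ _ _ T Tinv V beta theta n (fun i => x + i%:Z) w.
rewrite addr0 => /(_ _)/le_trans; apply.
  by move=> i; left; rewrite intS (addrC 1) addrA.
have -> : \sum_(i < n) V (iterz T Tinv (x + i%:Z) w) =
    primitive v (x + n%:Z) - primitive v x.
  elim: n => [|n IH]; first by rewrite big_ord0 addr0 subrr.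
  by rewrite big_ord_recr /= IH intS (addrC 1) addrA primitiveS; ring.
have := FC (x + n%:Z); have := FC x.
rewrite !rmorphD /= -pmulrn; move: (n%:R : R) (ler0n R n) => N N0.
move: (x%:~R : R) => X; set e := eta / _ in e0 *; rewrite !ler_norml.
move=> /andP[b1 b1'] /andP[b2 b2'].
have be : beta * e = eta / 2 by rewrite /e; field; rewrite gt_eqF.
have nY : `|X + N| <= `|X| + N.
  by have := ler_normD X N; rewrite (ger0_norm N0).
have eY := ler_wpM2l (ltW e0) nY.
have FF : primitive v (x + n%:Z) - primitive v x <=
    mu * N + (e * (2 * `|X| + N) + 2 * C) by lra.
have := ler_wpM2l (ltW beta_gt0) FF.
rewrite (mulrDr beta (mu * N)) (mulrDr beta (e * _)) (mulrA beta e) be.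
by have := mulr_ge0 (ltW eta0) N0; lra.
Qed.

Lemma value_upper_down eta : 0 < eta -> exists C : R, forall n x,
  value n x <= (beta * mu - theta) * n%:R + theta * x%:~R
    + (eta * (n%:R + `|x%:~R|) + C).
Proof.
move=> eta0; have e0 : 0 < eta / (2 * beta) by rewrite divr_gt0 // mulr_gt0.
have [C FC] := v_slope e0; exists (eta + 2 * beta * C) => n x.
have := @value_le_path _ _ _ T Tinv V beta theta n (fun i => x - i%:Z) w.
rewrite subr0 => /(_ _)/le_trans; apply.
  by move=> i; right; rewrite intS opprD (addrC (-1)) addrA.
(* The downward walk collects the sites [x, ..., x - n + 1], whence the shift by one. *)
have -> : \sum_(i < n) V (iterz T Tinv (x - i%:Z) w) =
    primitive v (x + 1) - primitive v (x + 1 - n%:Z).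
  elim: n => [|n IH]; first by rewrite big_ord0 subr0 subrr.
  rewrite big_ord_recr /= IH.
  have := primitiveS v (x - n%:Z); rewrite addrAC => ->.
  rewrite (_ : x + 1 - n.+1%:Z = x - n%:Z); last by lia.
  by ring.
have := FC (x + 1 - n%:Z); have := FC (x + 1).
rewrite !rmorphD !rmorphN /= mulr1z -pmulrn; move: (n%:R : R) (ler0n R n) => N N0.
move: (x%:~R : R) => X; set e := eta / _ in e0 *; rewrite !ler_norml.
move=> /andP[b1 b1'] /andP[b2 b2'].
have be : beta * e = eta / 2 by rewrite /e; field; rewrite gt_eqF.
have nX1 : `|X + 1| <= `|X| + 1 by have := ler_normD X 1; rewrite normr1.
have nY : `|X + 1 - N| <= `|X| + 1 + N.
  by have := ler_normB (X + 1) N; rewrite (ger0_norm N0); lra.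
have eY := ler_wpM2l (ltW e0) nY; have eX1 := ler_wpM2l (ltW e0) nX1.
have FF : primitive v (x + 1) - primitive v (x + 1 - n%:Z) <=
    mu * N + (e * (2 * `|X| + N + 2) + 2 * C) by lra.
have := ler_wpM2l (ltW beta_gt0) FF.
rewrite (mulrDr beta (mu * N)) (mulrDr beta (e * _)) (mulrA beta e) be.
by have := mulr_ge0 (ltW eta0) N0; lra.
Qed.

Hypothesis v_low : forall h eta : R, 0 < h -> 0 < eta -> exists C : R,
  forall x : int, exists2 j : nat, j%:R <= eta * `|x%:~R| + C &
    (v (x + j%:Z) <= h) && (v (x + j%:Z + 1) <= h).

(** A walk cannot stay put, so waiting takes two adjacent low sites. Each of the [j] steps towards
    them costs at most [beta] in potential and [|theta|] in displacement, whence the factor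
    [beta + |theta|]; a later step costs at most [eta] in potential. *)
Lemma value_upper_wait eta : 0 < eta -> exists C : R, forall n x,
  value n x <= theta * x%:~R + (eta * (n%:R + `|x%:~R|) + C).
Proof.
move=> eta0; have h0 : 0 < eta / beta by rewrite divr_gt0.
have K0 : 0 < beta + `|theta| by rewrite ltr_pwDl.
have [C hit] := v_low h0 (divr_gt0 eta0 K0).
exists ((beta + `|theta|) * C + `|theta|) => n x.
have {hit} [j jC /andP[lo1 lo2]] := hit x.
pose X i : int := x + (minn i j + odd (i - j))%:Z.
have := @value_le_path _ _ _ T Tinv V beta theta n X w.
have -> : X 0%N = x by rewrite /X min0n sub0n addr0.
move=> /(_ (fun i => wait_path_nearest_neighbor x i j))/le_trans; apply.
have sumV : \sum_(i < n) V (iterz T Tinv (X i) w) <= j%:R + eta / beta * n%:R.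
  have Vi (i : 'I_n) : V (iterz T Tinv (X i) w) <= (i < j)%N%:R + eta / beta.
    case: (ltnP i j) => ij /=.
      by rewrite ler_wpDr ?(ltW h0) //; case/andP: (V01 (iterz T Tinv (X i) w)).
    rewrite add0r /X (minn_idPr ij) PoszD addrA.
    by case: (odd _); rewrite ?addr0.
  apply: le_trans (ler_sum _ (fun i _ => Vi i)) _.
  rewrite big_split /= sumr_const card_ord mulr_natr lerD2r -natr_sum ler_nat.
  by rewrite sum_ltn_ord geq_minr.
have XnE : `|(X n)%:~R - x%:~R : R| <= j%:R + 1.
  rewrite -rmorphB /= /X addrAC subrr add0r -pmulrn ger0_norm // natr1 ler_nat.
  by rewrite -addn1 leq_add ?geq_minr ?leq_b1.
have tX : theta * ((X n)%:~R - x%:~R) <= `|theta| * (j%:R + 1).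
  by apply: le_trans (ler_norm _) _; rewrite normrM ler_wpM2l.
have bS : beta * (\sum_(i < n) V (iterz T Tinv (X i) w)) <=
    beta * j%:R + eta * n%:R.
  have -> : beta * j%:R + eta * n%:R = beta * (j%:R + eta / beta * n%:R).
    by field; rewrite gt_eqF.
  by rewrite ler_pM2l.
have Kj : (beta + `|theta|) * j%:R <=
    eta * `|x%:~R| + (beta + `|theta|) * C.
  apply: le_trans (ler_wpM2l (ltW K0) jC) _.
  by rewrite mulrDr mulrA mulrCA divff ?mulr1 // gt_eqF.
lra.
Qed.

(** Uniformity of [C] in [n] and [x] is essential, since both vary with [eps] under the scaling. *)
Lemma value_asymptotics eta : 0 < eta -> exists C : R, forall n x,
  `|value n x - (n%:R * Num.min 0 (beta * mu - `|theta|) + theta * x%:~R)| <=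
  eta * (n%:R + `|x%:~R|) + C.
Proof.
move=> eta0.
have [C1 low] := value_lower eta0; have [C2 up] := value_upper_up eta0.
have [C3 down] := value_upper_down eta0; have [C4 wait] := value_upper_wait eta0.
exists (`|C1| + `|C2| + `|C3| + `|C4|) => n x.
have := low n x; have := up n x; have := down n x; have := wait n x.
have N0 := ler0n R n.
have l1 := ler_norm C1; have l2 := ler_norm C2.
have l3 := ler_norm C3; have l4 := ler_norm C4.
have p1 := normr_ge0 C1; have p2 := normr_ge0 C2.
have p3 := normr_ge0 C3; have p4 := normr_ge0 C4.
move: (value n x) => W g1 g2 g3 g4; rewrite ler_norml.
have [H0|H0] := leP 0 (beta * mu - `|theta|).
  by rewrite (min_idPl H0) in g4 *; apply/andP; split; lra.
rewrite (min_idPr (ltW H0)) in g4 *.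
by case: (leP 0 theta) g4 => t0; [rewrite ger0_norm //|rewrite ltr0_norm //];
  move=> g4; apply/andP; split; lra.
Qed.

End value_asymptotics.

Lemma scaling_limit (R : realType) (W : nat -> int -> R) (H theta : R) :
  (forall eta : R, 0 < eta -> exists C : R, forall n x,
     `|W n x - (n%:R * H + theta * x%:~R)| <= eta * (n%:R + `|x%:~R|) + C) ->
  forall t x : R, 0 < t ->
  eps * W (Num.truncn (eps^-1 * t)) (Num.floor (eps^-1 * x)) @[eps --> 0^'+]
    --> t * H + theta * x.
Proof.
move=> WH t x t0; apply/cvgrPdist_le => e e0.
(* [K] bounds [eps * (n + |m|)] for [eps <= 1], and [D] below gathers the errors of order [eps]: the
   constant [C] and the two roundings. Each group gets half of [e]. *)
pose K := t + `|x| + 1.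
have K0 : 0 < K by rewrite ltr_wpDl // addr_ge0 // ltW.
have eta0 : 0 < e / (2 * K) by rewrite divr_gt0 // mulr_gt0.
have [C WC] := WH _ eta0.
pose D := `|C| + `|H| + `|theta| + 1.
have D0 : 0 < D by rewrite ltr_wpDl // !addr_ge0.
have D'0 : 0 < e / (2 * D) by rewrite divr_gt0 // mulr_gt0.
near=> eps.
have eps0 : 0 < eps by near: eps; exact: nbhs_right_gt.
have eps1 : eps <= 1 by near: eps; exact: nbhs_right_le.
have epsD : eps <= e / (2 * D) by near: eps; exact: nbhs_right_le.
set n := Num.truncn _; set m := Num.floor _.
have [n1 n2] : eps * n%:R <= t /\ t < eps * n%:R + eps.
  have /andP[] : n%:R <= eps^-1 * t < n.+1%:R.
    by apply: truncn_itv; rewrite mulr_ge0 ?invr_ge0 // ltW.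
  rewrite -natr1; split.
    by rewrite -ler_pdivlMl.
  by rewrite -[X in _ + X]mulr1 -mulrDr -ltr_pdivrMl.
have [m1 m2] : eps * m%:~R <= x /\ x < eps * m%:~R + eps.
  have m1 : m%:~R <= eps^-1 * x by exact: floor_le.
  have m2 : eps^-1 * x < (m + 1)%:~R by exact: floorD1_gt.
  rewrite rmorphD /= in m2; split; first by rewrite -ler_pdivlMl.
  by rewrite -[X in _ + X]mulr1 -mulrDr -ltr_pdivrMl.
have em : eps * `|m%:~R| <= `|x| + eps.
  rewrite -{1}(gtr0_norm eps0) -normrM.
  have := ler_norm x; have := lerNnormlW (lexx `|x|) => ? ?.
  by rewrite ler_norml; apply/andP; split; lra.
have bd : eps * `|W n m - (n%:R * H + theta * m%:~R)| <= e / 2 + eps * C.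
  apply: le_trans (ler_wpM2l (ltW eps0) (WC n m)) _.
  rewrite mulrDr mulrCA lerD2r.
  have -> : e / 2 = e / (2 * K) * K by field; rewrite gt_eqF.
  by rewrite ler_pM2l // mulrDr /K; lra.
rewrite -{1}(gtr0_norm eps0) -normrM in bd.
have dH : `|(t - eps * n%:R) * H| <= eps * `|H|.
  by rewrite normrM ler_wpM2r // ler_norml; apply/andP; split; lra.
have dtheta : `|theta * (x - eps * m%:~R)| <= eps * `|theta|.
  by rewrite normrM mulrC ler_wpM2r // ler_norml; apply/andP; split; lra.
have eD : eps * D <= e / 2.
  have -> : e / 2 = e / (2 * D) * D by field; rewrite gt_eqF.
  by rewrite ler_pM2r.
have eC : eps * C <= eps * `|C| by rewrite ler_pM2l // ler_norm.
have -> : t * H + theta * x - eps * W n m =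
    (t - eps * n%:R) * H + theta * (x - eps * m%:~R)
    - eps * (W n m - (n%:R * H + theta * m%:~R)) by ring.
apply: le_trans (ler_normB _ _) _.
have := ler_normD ((t - eps * n%:R) * H) (theta * (x - eps * m%:~R)).
by move: eD; rewrite /D; lra.
Unshelve. all: by end_near. Qed.

(** * Almost sure homogenization *)

Lemma iterzS (Omega : Type) (T Tinv : Omega -> Omega) (y : int) w :
  cancel Tinv T -> iterz T Tinv (y + 1) w = T (iterz T Tinv y w).
Proof.
move=> TinvK; case: y => [n|[|n]].
- by rewrite (_ : Posz n + 1 = n.+1%:Z) //; lia.
- by rewrite /= TinvK.
by rewrite (_ : Negz n.+1 + 1 = Negz n) /= ?TinvK // !NegzE; lia.
Qed.

Theorem theorem2p1 (R : realType) (d : measure_display)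
  (Omega : measurableType d) (P : probability Omega R)
  (T Tinv : Omega -> Omega)
  (TK : cancel T Tinv) (TinvK : cancel Tinv T)
  (mTinv : measurable_fun setT Tinv)
  (T_mp : measure_preserving P T) (T_erg : ergodic P T)
  (V : Omega -> R)
  (mV : measurable_fun setT V)
  (V01 : forall w, 0 <= V w <= 1)
  (V_nonconst : ~ exists c : R, forall w, V w = c)
  (V_inf : ess_inf P (fun w => (V w)%:E) = 0%E)
  (V_sup : ess_sup P (fun w => (V w)%:E) = 1%E)
  (V_low : forall (h : R) (l : nat), 0 < h < 1 -> (0 < l)%N ->
     (0 < P [set w | forall y : nat, (y <= l)%N ->
                       (V (iterz T Tinv y%:Z w) <= h)%R])%E)
  (V_high : forall (h : R) (l : nat), 0 < h < 1 -> (0 < l)%N ->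
     (0 < P [set w | forall y : nat, (y <= l)%N ->
                       (h <= V (iterz T Tinv y%:Z w))%R])%E)
  (beta theta : R) (beta_gt0 : 0 < beta) :
  {ae P, forall w,
    [/\ forall t x : R, 0 < t ->
          cvg (rescaled_value T Tinv V t x w 1 beta theta eps @[eps --> 0^'+]),
        forall t x : R, 0 < t ->
          limit_value T Tinv V t x w 1 beta theta =
          t * effective_hamiltonian T Tinv V w 1 beta theta + theta * x &
        effective_hamiltonian T Tinv V w 1 beta theta =
          if `|theta| < beta * fine 'E_P[V] then 0
          else beta * fine 'E_P[V] - `|theta|]}.
Proof.
have V0 w : 0 <= V w by case/andP: (V01 w).
have EV : ('E_P[V] = \int[P]_w (V w)%:E)%E by rewrite unlock.
have EVE : (\int[P]_w (V w)%:E = (fine 'E_P[V])%:E)%E.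
  rewrite EV fineK // ge0_fin_numE; last first.
    by apply: integral_ge0 => w _; rewrite lee_fin.
  apply: (@le_lt_trans _ _ (\int[P]_w (cst 1%:E w))%E).
    apply: ge0_le_integral => //.
    - by move=> w _; rewrite lee_fin.
    - exact/measurable_EFinP.
    - by move=> w _; rewrite lee_fin; case/andP: (V01 w).
  rewrite integral_cst // mul1e; apply: le_lt_trans (ltry 1).
  exact: probability_le1.
have V_slope := ae_has_slope TK mTinv T_mp T_erg mV V01 EVE.
have [mT PT] := T_mp.
(* Countably many thresholds let one null set serve every [h]; [k.+2] keeps them below 1, as [V_low]
   demands. *)
pose low k w := (V w <= k.+2%:R^-1) && (V (T w) <= k.+2%:R^-1).
have low_slope k : {ae P, forall w, exists2 p : R, 0 < p &
    has_slope (primitive (fun y => (low k (iterz T Tinv y w))%:R)) p}.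
  have mlow : measurable [set w | low k w].
    have mle (f : Omega -> R) c : measurable_fun setT f ->
        measurable [set w | f w <= c].
      move=> mf; under eq_set do rewrite -lerN2.
      exact/measurable_ler_cst/measurableT_comp.
    rewrite (_ : [set w | _] = [set w | V w <= k.+2%:R^-1] `&`
      [set w | (V \o T) w <= k.+2%:R^-1]).
      by apply: measurableI; apply: mle => //; exact: measurableT_comp.
    by apply/seteqP; split=> w /=; [move/andP|move=> ?; apply/andP].
  have ind w : (low k w)%:R = \1_[set w | low k w] w :> R.
    by rewrite indicE; congr (_%:R); rewrite (_ : (_ \in _) = low k w) //;
      apply/idP/idP; rewrite inE.
  have mind : measurable_fun setT (fun w => (low k w)%:R : R).
    by rewrite (_ : (fun w => _) = \1_[set w | low k w]) //; apply/funext.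
  have indP : (\int[P]_w (low k w)%:R%:E = (fine (P [set w | low k w]))%:E)%E.
    under eq_integral do rewrite ind.
    by rewrite integral_indic // setIT fineK // fin_num_measure.
  have ind01 w : 0 <= ((low k w)%:R : R) <= 1.
    by case: (low k w); rewrite ?lexx ?ler01.
  (* The density of low pairs is positive by [V_low] with [l = 1]. *)
  have pos : 0 < fine (P [set w | low k w]).
    apply: fine_gt0; rewrite -ge0_fin_numE // fin_num_measure // andbT.
    have h01 : 0 < (k.+2%:R^-1 : R) < 1.
      by rewrite invr_gt0 ltr0n invf_lt1 ?ltr1n.
    have := V_low _ 1%N h01 isT; congr (_ < P _)%E.
    apply/seteqP; split=> w /= => [lo|/andP[lo0 lo1] [|[|//]] //].
    by rewrite /low (lo 0%N) // (lo 1%N).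
  apply: filterS (ae_has_slope TK mTinv T_mp T_erg mind ind01 indP) => w.
  by exists (fine (P [set w | low k w])).
have := ae_foralln low_slope; apply: filterS2 V_slope => w v_slope lows.
have v_low (h eta : R) : 0 < h -> 0 < eta -> exists C : R,
    forall x : int, exists2 j : nat, j%:R <= eta * `|x%:~R| + C &
    (V (iterz T Tinv (x + j%:Z) w) <= h) &&
    (V (iterz T Tinv (x + j%:Z + 1) w) <= h).
  move=> h0 eta0; have [p p0 slope] := lows (Num.truncn h^-1).
  have [C hit] := hits_of_slope p0 slope eta0; exists C => x.
  have [j jC /andP[lo1 lo2]] := hit x; exists j => //.
  have hk : (Num.truncn h^-1).+2%:R^-1 <= h.
    by rewrite invf_ple ?posrE // ltW // (lt_trans (truncnS_gt _)) // ltr_nat.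
  by rewrite iterzS // (le_trans lo1) // (le_trans lo2).
have cvH t x : 0 < t -> rescaled_value T Tinv V t x w 1 beta theta eps @[eps --> 0^'+]
    --> t * Num.min 0 (beta * fine 'E_P[V] - `|theta|) + theta * x.
  move=> t0; apply: (@scaling_limit _
    (fun n x => value T Tinv V n x w 1 beta theta) _ _ _ t x t0) => eta eta0.
  exact: (value_asymptotics theta V01 beta_gt0 v_slope v_low eta0).
have limE t x : 0 < t -> limit_value T Tinv V t x w 1 beta theta =
    t * Num.min 0 (beta * fine 'E_P[V] - `|theta|) + theta * x.
  by move=> t0; apply: cvg_lim => //; exact: cvH.
have effE : effective_hamiltonian T Tinv V w 1 beta theta =
    Num.min 0 (beta * fine 'E_P[V] - `|theta|).
  by rewrite /effective_hamiltonian limE // mul1r mulr0 addr0.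
split=> [t x t0|t x t0|].
- by apply/cvg_ex; eexists; exact: cvH.
- by rewrite limE // effE.
rewrite effE; case: ltP => tE; first by apply/min_idPl; rewrite subr_ge0 ltW.
by apply/min_idPr; rewrite subr_le0.
Qed.
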